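(* Fix $N,K,b,M\in\mathbb{N}$ (all $\ge 1$), $Z_0>0$, $P_T>0$, $\sigma^2>0$, channel samples $\mathbf{H}^{(m)}=[\mathbf{h}^{(m)}_1,\dots,\mathbf{h}^{(m)}_K]^H\in\mathbb{C}^{K\times N}$, $m=1,\dots,M$, and a set $\mathcal{D}$ of disconnected port pairs with complement $\mathcal{E}$ as in the context. Let $(\mathrm{SD})$ be the discrete sample-average codebook design problem and, for $\rho>0$, let $(\mathrm{SC}_\rho)$ be its continuous penalty problem, both defined in the context (in both, the quantization parameter $c\ge 0$ is an optimization variable). Then there exists a constant $\bar\rho>0$ such that, for any $\rho>\bar\rho$, problems $(\mathrm{SD})$ and $(\mathrm{SC}_\rho)$ are globally equivalent, in the following sense: (i) any optimal solution of $(\mathrm{SD})$ is also an optimal solution of $(\mathrm{SC}_\rho)$; (ii) conversely, any optimal solution of $(\mathrm{SC}_\rho)$ satisfies $\bar B_{i,j}^{(m,\ell)}\in\{-c,c\}$ for all $(i,j)\in\mathcal{E}$, $\ell=1,\dots,b$, $m=1,\dots,M$, where $c$ is the value of the quantization parameter in that solution, and is also an optimal solution of $(\mathrm{SD})$.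
   Context: **Ports.** There are $N+K$ ports; ports $1,\dots,K$ are input ports and ports $K+1,\dots,K+N$ are output ports. $\mathcal{D}\subseteq\{(i,j): 1\le i,j\le N+K,\ i\ne j\}$ is a given set of disconnected port pairs, symmetric in the sense that $(i,j)\in\mathcal{D}$ iff $(j,i)\in\mathcal{D}$. Put $\mathcal{E}=\{(i,j): 1\le i,j\le N+K\}\setminus\mathcal{D}$ (so all self-pairs $(i,i)$ belong to $\mathcal{E}$). Standing assumption: at least one input port is connected to an output port, i.e. there are $k_0\in\{1,\dots,K\}$ and $r_0\in\{K+1,\dots,K+N\}$ with $(k_0,r_0)\in\mathcal{E}$. **Notation.** $\mathrm{i}$ is the imaginary unit. $\bar{\mathbf I}_1=\begin{bmatrix}\mathbf I_K\\ \mathbf 0_{N\times K}\end{bmatrix}\in\mathbb{R}^{(N+K)\times K}$ and $\bar{\mathbf I}_2=[\mathbf 0_{N\times K}\ \ \mathbf I_N]\in\mathbb{R}^{N\times (N+K)}$. For $\mathbf H=[\mathbf h_1,\dots,\mathbf h_K]^H\in\mathbb{C}^{K\times N}$, $\bar{\mathbf F}\in\mathbb{C}^{(N+K)\times K}$ with columns $\bar{\mathbf f}_1,\dots,\bar{\mathbf f}_K$, and $\mathbf p\in\mathbb{R}^K$ with $\mathbf p\ge\mathbf 0$, the sum rate is $$R(\mathbf p,\bar{\mathbf F};\mathbf H)=\sum_{k=1}^K\log_2\left(1+\frac{|\mathbf h_k^H\bar{\mathbf I}_2\bar{\mathbf f}_k|^2p_k}{\sum_{j\ne k}|\mathbf h_k^H\bar{\mathbf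 I}_2\bar{\mathbf f}_j|^2p_j+\sigma^2}\right).$$ **The set $\mathcal{X}$.** $\mathcal{X}$ is the set of tuples $\mathcal{U}=(\mathbf p,\bar{\mathbf F},\mathbf B,\{\bar B_{i,j}\},\{\bar B_{i,j}^{(\ell)}\})$ with $\mathbf p\in\mathbb{R}^K$, $\bar{\mathbf F}\in\mathbb{C}^{(N+K)\times K}$, $\mathbf B\in\mathbb{R}^{(N+K)\times(N+K)}$, $\bar B_{i,j}\in\mathbb{R}$ ($1\le i,j\le N+K$), $\bar B_{i,j}^{(\ell)}\in\mathbb{R}$ ($(i,j)\in\mathcal{E}$, $\ell=1,\dots,b$) satisfying 1. $\mathrm{i}Z_0\mathbf B(\bar{\mathbf F}+\bar{\mathbf I}_1)=\bar{\mathbf I}_1-\bar{\mathbf F}$; 2. $[\mathbf B]_{i,j}=-\bar B_{i,j}$ for $i\ne j$, and $[\mathbf B]_{i,i}=\bar B_{i,i}+\sum_{n\ne i}\bar B_{i,n}$; 3. $\bar B_{i,j}=0$ for all $(i,j)\in\mathcal{D}$; 4. $\bar B_{i,j}=\sum_{\ell=1}^b2^{\ell-1}\bar B_{i,j}^{(\ell)}$ for all $(i,j)\in\mathcal{E}$; 5. $\bar B_{j,i}^{(\ell)}=\bar B_{i,j}^{(\ell)}$ for all $(i,j)\in\mathcal{E}$, $\ell=1,\dots,b$; 6. $\mathbf 1^T\mathbf p\le P_T$ and $\mathbf p\ge\mathbf 0$. The variables are $c\ge 0$ and tuples $\mathcal{U}^{(m)}=(\mathbf p^{(m)},\bar{\mathbf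 F}^{(m)},\mathbf B^{(m)},\{\bar B_{i,j}^{(m)}\},\{\bar B_{i,j}^{(m,\ell)}\})$, $m=1,\dots,M$. **Discrete problem $(\mathrm{SD})$.** Maximize $\frac1M\sum_{m=1}^MR(\mathbf p^{(m)},\bar{\mathbf F}^{(m)};\mathbf H^{(m)})$ over $c\ge0$ and $\{\mathcal{U}^{(m)}\}_{m=1}^M$ subject to $\mathcal{U}^{(m)}\in\mathcal{X}$ for all $m$ and $\bar B_{i,j}^{(m,\ell)}\in\{-c,c\}$ for all $(i,j)\in\mathcal{E}$, $\ell=1,\dots,b$, $m=1,\dots,M$. **Penalty problem $(\mathrm{SC}_\rho)$.** Maximize $$\frac1M\sum_{m=1}^MR(\mathbf p^{(m)},\bar{\mathbf F}^{(m)};\mathbf H^{(m)})+\frac{\rho}{2}\cdot\frac1M\sum_{m=1}^M\sum_{\ell=1}^b\ \sum_{(i,j)\in\mathcal{E},\,j\ge i}\left(\left(\bar B_{i,j}^{(m,\ell)}\right)^2-c^2\right)$$ over $c\ge 0$ and $\{\mathcal{U}^{(m)}\}_{m=1}^M$ subject to $\mathcal{U}^{(m)}\in\mathcal{X}$ for all $m$ and $\bar B_{i,j}^{(m,\ell)}\in[-c,c]$ for all $(i,j)\in\mathcal{E}$, $\ell=1,\dots,b$, $m=1,\dots,M$. *)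

(* Defs.v *)
From mathcomp Require Import all_boot all_order all_algebra.
From mathcomp Require Export reals exp.
From mathcomp.real_closed Require Export complex.

Set Implicit Arguments.
Unset Strict Implicit.
Unset Printing Implicit Defensive.

Import Order.TTheory GRing.Theory Num.Theory.

Local Open Scope ring_scope.
Local Open Scope complex_scope.

(* Ports are indexed by 'I_(K + N): input port k is [lshift N k] and the n-th
   output port is [rshift K n], so inputs come first. *)
Notation port K N := 'I_(K + N).

(* E is the complement of D; it contains every self-pair when D is
   irreflexive. *)
Definition connected (K N : nat) (D : {set port K N * port K N}) :
  {set port K N * port K N} := ~: D.

(* Only the connected pairs carry bit variables; a design indexes them by this
   subtype. *)
Notation edge D := {e | e \in connected D}.

Definition edge_src (K N : nat) (D : {set port K N * port K N}) (e : edge D) :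
  port K N := (val e).1.
Definition edge_dst (K N : nat) (D : {set port K N * port K N}) (e : edge D) :
  port K N := (val e).2.

Definition I1bar (R : realType) (K N : nat) : 'M[R[i]]_(K + N, K) :=
  col_mx 1%:M 0.
Definition I2bar (R : realType) (K N : nat) : 'M[R[i]]_(N, K + N) :=
  row_mx 0 1%:M.

Definition log2 (R : realType) (x : R) : R := ln x / ln 2.

(* The channel matrix is H = [h_1, ..., h_K]^H, so [row k H] is h_k^H; this is
   |h_k^H I2bar f_j|^2, as a real number. *)
Definition gain (R : realType) (K N : nat) (H : 'M[R[i]]_(K, N))
    (F : 'M[R[i]]_(K + N, K)) (k j : 'I_K) : R :=
  ComplexField.Normc.normc ((row k H *m I2bar R K N *m col j F) 0 0) ^+ 2.

Definition rate (R : realType) (K N : nat) (sigma2 : R)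
    (p : 'cV[R]_K) (F : 'M[R[i]]_(K + N, K)) (H : 'M[R[i]]_(K, N)) : R :=
  \sum_(k < K)
    log2 (1 + gain H F k k * p k 0
              / (\sum_(j < K | j != k) gain H F k j * p j 0 + sigma2)).

(* A tuple (p, Fbar, B, Bbar, Bbar^(l)), in this order: [susc] is the matrix B,
   [branch] the branch values Bbar_ij, and [bit e l] is Bbar_ij^(l) for the
   connected pair e = (i, j). *)
Record design (R : realType) (K N b : nat) (D : {set port K N * port K N}) :=
  Design {
    power : 'cV[R]_K;
    beam : 'M[R[i]]_(K + N, K);
    susc : 'M[R]_(K + N);
    branch : 'M[R]_(K + N);
    bit : edge D -> 'I_b -> R }.

(* The set X. The bit weights 2^(l-1), l = 1..b, become 2^l for l : 'I_b. *)
Record feasible_design (R : realType) (K N b : nat)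
    (D : {set port K N * port K N}) (Z0 PT : R) (U : design R b D) : Prop := {
  beam_eq :
    ('i%C * Z0%:C) *: (map_mx (real_complex R) (susc U)
                       *m (beam U + I1bar R K N))
      = I1bar R K N - beam U;
  susc_offdiag : forall i j : port K N, i != j ->
    susc U i j = - branch U i j;
  susc_diag : forall i : port K N,
    susc U i i = branch U i i + \sum_(n < K + N | n != i) branch U i n;
  branch_disconnected : forall i j : port K N, (i, j) \in D ->
    branch U i j = 0;
  branch_bits : forall e : edge D,
    branch U (edge_src e) (edge_dst e) = \sum_(l < b) 2 ^+ l * bit U e l;
  bit_sym : forall (e e' : edge D) (l : 'I_b),
    edge_src e' = edge_dst e -> edge_dst e' = edge_src e ->
    bit U e' l = bit U e l;
  power_budget : \sum_(k < K) power U k 0 <= PT;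
  power_ge0 : forall k : 'I_K, 0 <= power U k 0 }.

Record codebook (R : realType) (K N b M : nat)
    (D : {set port K N * port K N}) :=
  Codebook { level : R; sample : 'I_M -> design R b D }.

Definition feasible_codebook (R : realType) (K N b M : nat)
    (D : {set port K N * port K N}) (Z0 PT : R) (x : codebook R b M D) : Prop :=
  0 <= level x /\ forall m : 'I_M, feasible_design Z0 PT (sample x m).

Definition discrete_bits (R : realType) (K N b M : nat)
    (D : {set port K N * port K N}) (x : codebook R b M D) : Prop :=
  forall (m : 'I_M) (e : edge D) (l : 'I_b),
    bit (sample x m) e l = - level x \/ bit (sample x m) e l = level x.

Definition boxed_bits (R : realType) (K N b M : nat)
    (D : {set port K N * port K N}) (x : codebook R b M D) : Prop :=
  forall (m : 'I_M) (e : edge D) (l : 'I_b),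
    - level x <= bit (sample x m) e l <= level x.

Definition average_rate (R : realType) (K N b M : nat)
    (D : {set port K N * port K N}) (sigma2 : R)
    (H : 'I_M -> 'M[R[i]]_(K, N)) (x : codebook R b M D) : R :=
  M%:R^-1 * \sum_(m < M)
    rate sigma2 (power (sample x m)) (beam (sample x m)) (H m).

Definition penalty (R : realType) (K N b M : nat)
    (D : {set port K N * port K N}) (x : codebook R b M D) : R :=
  M%:R^-1 * \sum_(m < M) \sum_(l < b)
    \sum_(e : edge D | (edge_src e <= edge_dst e)%N)
      (bit (sample x m) e l ^+ 2 - level x ^+ 2).

Definition maximizer (R : realType) (T : Type) (feas : T -> Prop) (obj : T -> R)
    (x : T) : Prop :=
  feas x /\ forall y : T, feas y -> obj y <= obj x.

Definition SD_optimal (R : realType) (K N b M : nat)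
    (D : {set port K N * port K N}) (Z0 PT sigma2 : R)
    (H : 'I_M -> 'M[R[i]]_(K, N)) : codebook R b M D -> Prop :=
  maximizer (fun x => feasible_codebook Z0 PT x /\ discrete_bits x)
            (average_rate sigma2 H).

Definition SC_optimal (R : realType) (K N b M : nat)
    (D : {set port K N * port K N}) (Z0 PT sigma2 : R)
    (H : 'I_M -> 'M[R[i]]_(K, N)) (rho : R) : codebook R b M D -> Prop :=
  maximizer (fun x => feasible_codebook Z0 PT x /\ boxed_bits x)
            (fun x => average_rate sigma2 H x + rho / 2 * penalty x).

(* Main.v *)
(* For a symmetric susceptance matrix B the resolvent (1 + i Z0 B)^-1 is a
   contraction, and beam + I1bar = 2 (1 + i Z0 B)^-1 I1bar.  Hence the rate is
   globally Lipschitz in the bits, with a constant independent of the level c.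
   Rounding the bits of a relaxed point to -c or c thus costs at most C d in
   rate, d being the l1 distance to the rounded bits, whereas the penalty of the
   relaxed point is at most - c d.  It remains to bound c away from 0: at c = 0 no
   power is radiated, so the rate is O(c), and only points whose rate is at least
   that of a fixed discrete point of positive rate matter.
   If no discrete point has positive rate, then the rate vanishes on all relaxed
   points and the penalty alone decides: each branch value enters B through a
   rank-one term, so the channel response is a Moebius function of it, and if
   nonzero it stays so at one of any two prescribed values of that branch. *)

Require Import Defs.
From mathcomp Require Import all_boot all_order all_algebra.
From mathcomp Require Import reals exp.
From mathcomp.real_closed Require Import complex.
From mathcomp Require Import ring lra.
From mathcomp Require boolp.
Set Implicit Arguments.
Unset Strict Implicit.
Unset Printing Implicit Defensive.
Import Order.TTheory GRing.Theory Num.Theory.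
Local Open Scope ring_scope.
Local Open Scope complex_scope.

Local Notation normc := ComplexField.Normc.normc.
Local Notation Re := complex.Re.
Local Notation Im := complex.Im.

(** * Modulus, real part and imaginary part of complex numbers *)

Section Modulus.
Variable R : rcfType.
Implicit Types x y : R[i].

Lemma normc_ge0 x : 0 <= normc x.
Proof. by case: x => a b; apply: sqrtr_ge0. Qed.

Lemma sqr_normcE x : normc x ^+ 2 = Re x ^+ 2 + Im x ^+ 2.
Proof. by case: x => a b; rewrite sqr_sqrtr// addr_ge0// sqr_ge0. Qed.

Lemma normc_sum (I : finType) (F : I -> R[i]) :
  normc (\sum_i F i) <= \sum_i normc (F i).
Proof.
elim/big_ind2: _ => [|x a y b xa yb|//]; first by rewrite ComplexField.Normc.normc0.
exact: le_trans (le_normcD _ _) (lerD xa yb).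
Qed.

Lemma ler_dist_normc x y : `|normc x - normc y| <= normc (x - y).
Proof.
have aux u v : normc u - normc v <= normc (u - v).
  by rewrite lerBlDr -{1}(subrK v u) le_normcD.
rewrite ler_norml aux andbT lerNl opprB -(normcN (x - y)) opprB; exact: aux.
Qed.

Lemma sqr_lipschitz (a a' c d : R) : 0 <= a -> 0 <= a' -> a <= c -> a' <= c ->
  `|a - a'| <= d -> `|a ^+ 2 - a' ^+ 2| <= d * (2 * c).
Proof.
move=> a0 a'0 ac a'c ad; rewrite subr_sqr normrM (ger0_norm (addr_ge0 a0 a'0)).
by apply: ler_pM => //; [exact: addr_ge0 | rewrite mulr_natl mulr2n lerD].
Qed.

Lemma normc_real (a : R) : normc a%:C = `|a|.
Proof. by rewrite /= expr0n addr0 sqrtr_sqr. Qed.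

Lemma normc_i : normc 'i%C = 1 :> R.
Proof. by rewrite /= expr0n expr1n add0r sqrtr1. Qed.

Lemma ReD x y : Re (x + y) = Re x + Re y.
Proof. by case: x y => [a b] [c d]. Qed.

Lemma ImD x y : Im (x + y) = Im x + Im y.
Proof. by case: x y => [a b] [c d]. Qed.

Lemma Re_sum (I : finType) (F : I -> R[i]) : Re (\sum_i F i) = \sum_i Re (F i).
Proof. exact: (big_morph _ ReD). Qed.

Lemma Im_sum (I : finType) (F : I -> R[i]) : Im (\sum_i F i) = \sum_i Im (F i).
Proof. exact: (big_morph _ ImD). Qed.

Lemma ReM_real (a : R) x : Re (a%:C * x) = a * Re x.
Proof. by case: x => b c; rewrite /= mul0r subr0. Qed.

Lemma ImM_real (a : R) x : Im (a%:C * x) = a * Im x.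
Proof. by case: x => b c; rewrite /= mul0r addr0. Qed.

End Modulus.

(** * Entrywise l1 norms and bounds on matrix products *)

Section EntrywiseBounds.
Variable R : rcfType.

Definition l1norm m n (A : 'M[R]_(m, n)) : R := \sum_i \sum_j `|A i j|.

Definition l1normc m n (A : 'M[R[i]]_(m, n)) : R := \sum_i \sum_j normc (A i j).

Lemma l1norm_ge0 m n (A : 'M[R]_(m, n)) : 0 <= l1norm A.
Proof. by do 2!apply: sumr_ge0 => ? _. Qed.

Lemma l1normc_ge0 m n (A : 'M[R[i]]_(m, n)) : 0 <= l1normc A.
Proof. by do 2!(apply: sumr_ge0 => ? _); exact: normc_ge0. Qed.

(** In the expanded product each entry of [X] is weighted by an entry of row [i] of [A] and an entry
    of column [j] of [B]; the l1 norms of the full matrices dominate those of this row and this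
    column. *)
Lemma normc_mulmx_le m n p q (A : 'M[R[i]]_(m, n)) (X : 'M_(n, p))
    (B : 'M_(p, q)) (d : R) i j :
  0 <= d -> (forall a b, normc (X a b) <= d) ->
  normc ((A *m X *m B) i j) <= d * (l1normc A * l1normc B).
Proof.
move=> d0 Xd; pose s := \sum_a \sum_b d * (normc (A i a) * normc (B b j)).
apply: (@le_trans _ _ s).
  rewrite -mulmxA mxE; apply: le_trans (normc_sum _) _.
  apply: ler_sum => a _; rewrite mxE mulr_sumr.
  apply: le_trans (normc_sum _) _; apply: ler_sum => b _.
  rewrite !ComplexField.Normc.normcM mulrCA.
  by apply: ler_wpM2r; rewrite ?mulr_ge0 ?normc_ge0.
rewrite /s; under eq_bigr do rewrite -mulr_sumr -mulr_sumr.
rewrite -mulr_sumr -mulr_suml ler_wpM2l// ler_pM//.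
- by apply: sumr_ge0 => *; apply: normc_ge0.
- by apply: sumr_ge0 => *; apply: normc_ge0.
- rewrite /l1normc (bigD1 i)//= lerDl.
  by do 2!(apply: sumr_ge0 => ? _); exact: normc_ge0.
- apply: ler_sum => b _; rewrite (bigD1 j)//= lerDl.
  by apply: sumr_ge0 => ? _; exact: normc_ge0.
Qed.

End EntrywiseBounds.

(** * The resolvent of a real symmetric matrix *)

Section Resolvent.
Variables (R : rcfType) (n : nat) (z : R).
Implicit Types B : 'M[R]_n.

Definition admittance B : 'M[R[i]]_n :=
  1%:M + ('i%C * z%:C) *: map_mx (real_complex R) B.

Lemma mul_admittanceE B (x : 'cV_n) i :
  Re ((admittance B *m x) i 0) = Re (x i 0) - z * (\sum_j B i j * Im (x j 0)) /\
  Im ((admittance B *m x) i 0) = Im (x i 0) + z * (\sum_j B i j * Re (x j 0)).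
Proof.
rewrite mulmxDl mul1mx -scalemxAl !mxE -mulrA ReD ImD.
set s := \sum_j _.
have -> : \sum_j B i j * Im (x j 0) = Im s.
  by rewrite Im_sum; apply: eq_bigr => j _; rewrite mxE ImM_real.
have -> : \sum_j B i j * Re (x j 0) = Re s.
  by rewrite Re_sum; apply: eq_bigr => j _; rewrite mxE ReM_real.
rewrite -ReM_real -ImM_real; case: (z%:C * s) => a b /=.
by rewrite !mul0r !mul1r sub0r add0r.
Qed.

(* The imaginary part of the admittance is real symmetric, so it does not
   contribute to Re (x^* A x). *)
Lemma admittance_energy B (x : 'cV_n) : B^T = B ->
  \sum_i normc (x i 0) ^+ 2 =
  \sum_i (Re (x i 0) * Re ((admittance B *m x) i 0)
          + Im (x i 0) * Im ((admittance B *m x) i 0)).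
Proof.
move=> symB.
pose s := \sum_i \sum_j Re (x i 0) * (B i j * Im (x j 0)).
have s' : \sum_i \sum_j Im (x i 0) * (B i j * Re (x j 0)) = s.
  rewrite exchange_big; apply: eq_bigr => j _; apply: eq_bigr => i _.
  by rewrite -{1}symB mxE; ring.
apply/esym; transitivity (\sum_i normc (x i 0) ^+ 2 - z * s + z * s); last first.
  by rewrite subrK.
rewrite -{2}s' /s !mulr_sumr -sumrB -big_split; apply: eq_bigr => i _ /=.
have [-> ->] := mul_admittanceE B x i.
by rewrite -!mulr_sumr sqr_normcE; ring.
Qed.

(** A kernel vector has zero energy by [admittance_energy], hence is zero. The transpose turns the
    row kernel [kermx] into a kernel of columns. *)
Lemma unit_admittance B : B^T = B -> admittance B \in unitmx.
Proof.
move=> symB; rewrite -unitmx_tr -row_free_unit -kermx_eq0.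
apply/eqP/row_matrixP => k; rewrite row0.
set v := row k _; have Av : admittance B *m v^T = 0.
  by apply: trmx_inj; rewrite trmx_mul trmxK trmx0; apply: sub_kermxP; apply: row_sub.
have := admittance_energy v^T symB; rewrite Av.
rewrite [RHS]big1 => [/eqP|i _]; last first.
  by rewrite [(0 : 'cV_n) _ _]mxE -[Re 0]/(0 : R) -[Im 0]/(0 : R) !mulr0 addr0.
rewrite psumr_eq0 => [/allP v0|i _]; last exact: sqr_ge0.
apply/rowP => i; have /= := v0 i (mem_index_enum _).
by rewrite sqrf_eq0 !mxE => /eqP /ComplexField.Normc.eq0_normc.
Qed.

(** Column [j] of the inverse solves A x = e_j, so the energy identity reads |x|^2 = Re x_j. Hence
    Re x_j <= 1, and every |x_k|^2 is at most Re x_j. *)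
Lemma resolvent_entry_le1 B i j : B^T = B -> normc (invmx (admittance B) i j) <= 1.
Proof.
move=> symB; pose x := col j (invmx (admittance B)).
have Ax : admittance B *m x = delta_mx j 0.
  by rewrite /x colE mulmxA mulmxV ?mul1mx// unit_admittance.
have := admittance_energy x symB; rewrite Ax.
rewrite [RHS](bigD1 j)//= [X in _ + X]big1 => [|k kj]; last first.
  rewrite [delta_mx _ _ _ _]mxE (negPf kj).
  by rewrite -[Re _%:R]/(0 : R) -[Im _%:R]/(0 : R) !mulr0 addr0.
rewrite [delta_mx _ _ _ _]mxE !eqxx.
rewrite -[Re 1%:R]/(1 : R) -[Im 1%:R]/(0 : R) mulr1 mulr0 !addr0 => E.
have le k : normc (x k 0) ^+ 2 <= Re (x j 0).
  by rewrite -E (bigD1 k)//= lerDl; apply: sumr_ge0 => *; apply: sqr_ge0.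
have re1 : Re (x j 0) <= 1.
  have := le j; rewrite sqr_normcE; have := sqr_ge0 (Im (x j 0)).
  by move=> *; nra.
have := le_trans (le i) re1; rewrite /x mxE.
by have := normc_ge0 (invmx (admittance B) i j); nra.
Qed.

(** The second resolvent identity. *)
Lemma resolvent_sub B B' : B^T = B -> B'^T = B' ->
  invmx (admittance B) - invmx (admittance B') =
  invmx (admittance B)
    *m (('i%C * z%:C) *: map_mx (real_complex R) (B' - B))
    *m invmx (admittance B').
Proof.
move=> symB symB'.
have -> : ('i%C * z%:C) *: map_mx (real_complex R) (B' - B)
          = admittance B' - admittance B.
  by rewrite map_mxB scalerBr /admittance opprD addrACA subrr add0r.
rewrite mulmxBr mulmxBl mulVmx ?unit_admittance// mul1mx.
by rewrite -mulmxA mulmxV ?unit_admittance// mulmx1.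
Qed.

(** In [resolvent_sub] each entry of B' - B is multiplied by i z and by one entry of each resolvent,
    of modulus at most 1. *)
Lemma resolvent_lipschitz B B' i j : 0 <= z -> B^T = B -> B'^T = B' ->
  normc ((invmx (admittance B) - invmx (admittance B')) i j)
    <= z * l1norm (B - B').
Proof.
move=> z0 symB symB'; rewrite resolvent_sub// mxE /l1norm exchange_big mulr_sumr /=.
apply: le_trans (normc_sum _) _; apply: ler_sum => a _.
rewrite ComplexField.Normc.normcM mxE; set s := \sum_c _.
apply: (@le_trans _ _ (normc s)).
  by apply: ler_piMr; rewrite ?normc_ge0// resolvent_entry_le1.
apply: le_trans (normc_sum _) _; rewrite mulr_sumr; apply: ler_sum => c _.
rewrite !ComplexField.Normc.normcM.
rewrite [(_ *: _ : 'M_(_, _)) c a]mxE !ComplexField.Normc.normcM.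
rewrite [map_mx _ _ c a]mxE !normc_real normc_i mul1r ger0_norm//.
have -> : `|(B' - B) c a| = `|(B - B') c a| by rewrite !mxE distrC.
by apply: ler_piMl; rewrite ?mulr_ge0// resolvent_entry_le1.
Qed.

End Resolvent.

(** * Weighted graph Laplacians *)

Section Laplacian.
Variables (R : rcfType) (n : nat).
Implicit Types W : 'M[R]_n.

(** The weight [W i i] is a shunt: it enters only the diagonal, so that row [i] sums to [W i i]. *)
Definition laplacian W : 'M[R]_n :=
  \matrix_(i, j) if i == j then \sum_k W i k else - W i j.

Lemma laplacianB W W' : laplacian (W - W') = laplacian W - laplacian W'.
Proof.
apply/matrixP => i j; rewrite !mxE; case: eqP => _; last by rewrite opprD.
by rewrite -sumrB; apply: eq_bigr => k _; rewrite !mxE.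
Qed.

Lemma laplacian0 : laplacian 0 = 0.
Proof. by rewrite -{1}(subrr 0) laplacianB subrr. Qed.

Lemma tr_laplacian W : W^T = W -> (laplacian W)^T = laplacian W.
Proof.
move=> symW; apply/matrixP => i j; rewrite !mxE eq_sym; case: eqP => [->//|_].
by rewrite -{1}symW mxE.
Qed.

(** A weight counts at most twice: once off the diagonal and once in the diagonal sum of its row. *)
Lemma l1norm_laplacian_le W : l1norm (laplacian W) <= 2 * l1norm W.
Proof.
rewrite /l1norm mulr_sumr; apply: ler_sum => i _.
rewrite (bigD1 i)//= mxE eqxx mulrDl mul1r lerD ?ler_norm_sum//.
rewrite [leRHS](bigD1 i)//= -[leLHS]add0r lerD//.
by apply: ler_sum => j ji; rewrite mxE eq_sym (negPf ji) normrN.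
Qed.

End Laplacian.

(** * Beams and gains as functions of the branch values *)

Section Beam.
Variables (R : realType) (K N b : nat) (D : {set port K N * port K N}).
Variables (Z0 PT : R) (D_sym : forall i j, ((i, j) \in D) = ((j, i) \in D)).
Implicit Types (U : design R b D) (W : 'M[R]_(K + N)) (H : 'M[R[i]]_(K, N)).

Definition transfer W : 'M[R[i]]_(K + N) := invmx (admittance Z0 (laplacian W)).

Lemma sym_branch U : feasible_design Z0 PT U -> (branch U)^T = branch U.
Proof.
move=> fU; apply/matrixP => i j; rewrite mxE.
have [ijD|ijE] := boolP ((i, j) \in D).
  by rewrite !(branch_disconnected fU)// -D_sym.
have jiE : (j, i) \notin D by rewrite -D_sym.
move: ijE jiE; rewrite -!in_setC => ijE jiE.
rewrite (branch_bits fU (Sub (j, i) jiE)) (branch_bits fU (Sub (i, j) ijE)).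
apply: eq_bigr => l _; congr (_ * _).
by apply: (bit_sym fU); rewrite /edge_src /edge_dst !SubK.
Qed.

Lemma susc_laplacian U : feasible_design Z0 PT U -> susc U = laplacian (branch U).
Proof.
move=> fU; apply/matrixP => i j; rewrite mxE; case: eqP => [->|/eqP ij].
  by rewrite (susc_diag fU) [RHS](bigD1 j).
exact: susc_offdiag fU _ _ ij.
Qed.

(** Adding [F + I1bar] to both sides turns the equation into [admittance Z0 B *m (F + I1bar) = 2 *:
    I1bar], with an invertible admittance. *)
Lemma beam_eqP (B : 'M[R]_(K + N)) (F : 'M[R[i]]_(K + N, K)) : B^T = B ->
  ('i%C * Z0%:C) *: (map_mx (real_complex R) B *m (F + I1bar R K N))
    = I1bar R K N - F
  <-> F = 2 *: (invmx (admittance Z0 B) *m I1bar R K N) - I1bar R K N.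
Proof.
move=> symB; have unitA := unit_admittance Z0 symB.
have AE : admittance Z0 B *m (F + I1bar R K N) = F + I1bar R K N +
    ('i%C * Z0%:C) *: (map_mx (real_complex R) B *m (F + I1bar R K N)).
  by rewrite mulmxDl mul1mx -scalemxAl.
have two : 2 *: I1bar R K N = F + I1bar R K N + (I1bar R K N - F).
  by rewrite [RHS]addrC addrA subrK scaler_nat mulr2n.
split=> [E|FE].
  apply/(canRL (addrK _)); rewrite scalemxAr two -E -AE mulmxA mulVmx//.
  by rewrite mul1mx.
apply: (@addrI _ (F + I1bar R K N)); rewrite -AE -two {1}FE subrK.
by rewrite -scalemxAr mulmxA mulmxV// mul1mx.
Qed.

Lemma beamE U : feasible_design Z0 PT U ->
  beam U = 2 *: (transfer (branch U) *m I1bar R K N) - I1bar R K N.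
Proof.
move=> fU; have := beam_eq fU; rewrite /transfer -susc_laplacian//.
by move/beam_eqP => -> //; rewrite susc_laplacian// tr_laplacian// sym_branch.
Qed.

(** Removes the term [- I1bar] of the beam from the gains. *)
Lemma I2bar_I1bar : I2bar R K N *m I1bar R K N = 0.
Proof. by rewrite mul_row_col mul0mx mulmx0 addr0. Qed.

(** Half of the effective channel h_k^H I2bar f_j; the factor 2 of the beam reappears as the 4 of
    [gainE]. *)
Definition amplitude H W (k j : 'I_K) : R[i] :=
  (row k H *m I2bar R K N *m transfer W *m col j (I1bar R K N)) 0 0.

Lemma gainE H U k j : feasible_design Z0 PT U ->
  gain H (beam U) k j = 4 * normc (amplitude H (branch U) k j) ^+ 2.
Proof.
move=> fU; rewrite /gain beamE//.
have -> : row k H *m I2bar R K N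
      *m col j (2 *: (transfer (branch U) *m I1bar R K N) - I1bar R K N)
    = 2 *: (row k H *m I2bar R K N *m transfer (branch U) *m col j (I1bar R K N)).
  rewrite !colE mulmxBl mulmxBr [X in _ - X]mulmxA -(mulmxA (row k H) _ (I1bar R K N)).
  by rewrite I2bar_I1bar mulmx0 mul0mx subr0 -scalemxAl -scalemxAr !mulmxA.
rewrite mxE ComplexField.Normc.normcM -/(amplitude H (branch U) k j) exprMn.
have -> : (2 : R[i]) = (2 : R)%:C by rewrite rmorph_nat.
by rewrite normc_real ger0_norm// -natrX.
Qed.

(* With all branches at 0 the beam is I1bar, which reaches no output port. *)
Lemma amplitude0 H k j : amplitude H 0 k j = 0.
Proof.
rewrite /amplitude /transfer laplacian0 /admittance map_mx0 scaler0 addr0 invmx1.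
rewrite mulmx1 colE mulmxA -(mulmxA (row k H) _ (I1bar R K N)).
by rewrite I2bar_I1bar mulmx0 mul0mx mxE.
Qed.

(** A sum over all pairs, so that one constant serves every [k] and [j]. *)
Definition channel_bound H : R :=
  \sum_k \sum_j l1normc (row k H *m I2bar R K N) * l1normc (col j (I1bar R K N)).

Lemma channel_bound_ge0 H : 0 <= channel_bound H.
Proof. by do 2!(apply: sumr_ge0 => ? _); rewrite mulr_ge0 ?l1normc_ge0. Qed.

Lemma channel_bound_ge H k j :
  l1normc (row k H *m I2bar R K N) * l1normc (col j (I1bar R K N))
    <= channel_bound H.
Proof.
rewrite /channel_bound (bigD1 k)//= (bigD1 j)//= -addrA lerDl addr_ge0//.
  by apply: sumr_ge0 => ? _; rewrite mulr_ge0 ?l1normc_ge0.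
by do 2!(apply: sumr_ge0 => ? _); rewrite mulr_ge0 ?l1normc_ge0.
Qed.

Lemma amplitude_bound H W k j : W^T = W ->
  normc (amplitude H W k j) <= channel_bound H.
Proof.
move=> symW; apply: le_trans (channel_bound_ge H k j); rewrite -[leRHS]mul1r.
apply: normc_mulmx_le => // a c.
by apply: resolvent_entry_le1; apply: tr_laplacian.
Qed.

Lemma amplitude_lipschitz H W W' k j : 0 <= Z0 -> W^T = W -> W'^T = W' ->
  normc (amplitude H W k j - amplitude H W' k j)
    <= 2 * Z0 * channel_bound H * l1norm (W - W').
Proof.
move=> Z0ge symW symW'.
have -> : amplitude H W k j - amplitude H W' k j =
    (row k H *m I2bar R K N *m (transfer W - transfer W')
       *m col j (I1bar R K N)) 0 0.
  by rewrite mulmxBr mulmxBl [RHS]mxE [X in _ = _ + X]mxE.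
have d0 : 0 <= Z0 * (2 * l1norm (W - W')) by rewrite !mulr_ge0// l1norm_ge0.
have Xd a c : normc ((transfer W - transfer W') a c) <= Z0 * (2 * l1norm (W - W')).
  apply: le_trans (resolvent_lipschitz _ _ Z0ge _ _) _; rewrite ?tr_laplacian//.
  by rewrite -laplacianB ler_wpM2l// l1norm_laplacian_le.
apply: le_trans (normc_mulmx_le _ _ _ _ d0 Xd) _.
apply: le_trans (ler_wpM2l d0 (channel_bound_ge H k j)) _.
by rewrite le_eqVlt; apply/orP; left; apply/eqP; ring.
Qed.

(** With C the [channel_bound], the constant is the 4 of [gainE], times 2 Z0 C from
    [amplitude_lipschitz], times 2 C from factoring a difference of squares. *)
Lemma gain_lipschitz H U U' k j : 0 <= Z0 ->
  feasible_design Z0 PT U -> feasible_design Z0 PT U' ->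
  `|gain H (beam U) k j - gain H (beam U') k j|
    <= 16 * Z0 * channel_bound H ^+ 2 * l1norm (branch U - branch U').
Proof.
move=> Z0ge fU fU'; have symU := sym_branch fU; have symU' := sym_branch fU'.
rewrite !gainE// -mulrBr normrM ger0_norm//.
have ab := le_trans (ler_dist_normc _ _) (amplitude_lipschitz H k j Z0ge symU symU').
have sq := sqr_lipschitz (normc_ge0 _) (normc_ge0 _) (amplitude_bound H k j symU)
  (amplitude_bound H k j symU') ab.
apply: le_trans (ler_wpM2l (ler0n _ 4) sq) _.
by rewrite le_eqVlt; apply/orP; left; apply/eqP; ring.
Qed.

End Beam.

(** * Lipschitz dependence of the rate on the gains *)

Section Rate.
Variable R : realType.

(** Concavity: ln (x / y) <= x / y - 1 = (x - y) / y, and y >= s. *)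
Lemma ln_lipschitz (s x y : R) : 0 < s -> s <= x -> s <= y ->
  ln x - ln y <= `|x - y| / s.
Proof.
move=> s0 sx sy; have x0 := lt_le_trans s0 sx; have y0 := lt_le_trans s0 sy.
rewrite -ln_div ?posrE//.
have -> : x / y = 1 + (x - y) / y by rewrite mulrBl divff ?gt_eqF// subrKC.
apply: le_trans (le_ln1Dx _) _.
  by rewrite mulrBl divff ?gt_eqF// addrC ltrDl divr_gt0.
apply: le_trans (ler_norm _) _; rewrite normrM normfV (gtr0_norm y0).
by rewrite ler_wpM2l// lef_pV2 ?posrE.
Qed.

Lemma subB_le2 (a a' c c' e : R) : a - a' <= e -> c' - c <= e ->
  a - c - (a' - c') <= e + e.
Proof. by move=> *; lra. Qed.

Variables (K N : nat).
Implicit Types (p : 'cV[R]_K) (F : 'M[R[i]]_(K + N, K)) (H : 'M[R[i]]_(K, N)).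

Lemma gain_ge0 H F k j : 0 <= gain H F k j.
Proof. exact: sqr_ge0. Qed.

Definition interference (s : R) p F H (k : 'I_K) : R :=
  \sum_(j < K | j != k) gain H F k j * p j 0 + s.

(** Splits each term into two logarithms with arguments at least [s], to which [ln_lipschitz]
    applies separately. *)
Lemma rateE (s : R) p F H : 0 < s -> (forall k, 0 <= p k 0) ->
  rate s p F H = \sum_(k < K)
    (ln (\sum_j gain H F k j * p j 0 + s) - ln (interference s p F H k)) / ln 2.
Proof.
move=> s0 p0; apply: eq_bigr => k _; rewrite /log2; congr (_ / _).
have I0 : 0 < interference s p F H k.
  rewrite ltr_wpDl//; apply: sumr_ge0 => j _; rewrite mulr_ge0//.
  exact: gain_ge0.
have S0 : 0 <= gain H F k k * p k 0 by rewrite mulr_ge0 ?gain_ge0.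
rewrite -/(interference s p F H k) (bigD1 k)//= -addrA -/(interference s p F H k).
rewrite -ln_div ?posrE//; last exact: ltr_wpDl.
congr (ln _).
by rewrite mulrDl divff ?gt_eqF// addrC.
Qed.

(** A change of the gains by at most [d] moves the argument of each logarithm by at most P d; there
    are two logarithms for each of the K users. *)
Lemma rate_lipschitz (s P d : R) p F F' H : 0 < s ->
  (forall k, 0 <= p k 0) -> \sum_k p k 0 <= P ->
  (forall k j, `|gain H F k j - gain H F' k j| <= d) ->
  rate s p F H - rate s p F' H <= K%:R * (2 * P / s / ln 2) * d.
Proof.
move=> s0 p0 pP Gd; rewrite !rateE// -sumrB.
have -> : K%:R * (2 * P / s / ln 2) * d = \sum_(k < K) 2 * P / s / ln 2 * d.
  by rewrite sumr_const card_ord -mulrA mulr_natl.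
apply: ler_sum => k _; rewrite -mulrBl mulrAC ler_wpM2r ?invr_ge0 ?ln_ge0 ?ler1n//.
have d0 : 0 <= d by apply: le_trans (Gd k k).
(* Used with [predT] for the total received power and with [j != k] for the interference. *)
have dist (Q : pred 'I_K) :
    `|(\sum_(j | Q j) gain H F k j * p j 0 + s)
      - (\sum_(j | Q j) gain H F' k j * p j 0 + s)| <= P * d.
  rewrite opprD addrACA subrr addr0 -sumrB.
  apply: le_trans (ler_norm_sum _ _ _) _.
  apply: (@le_trans _ _ (\sum_j p j 0 * d)); last by rewrite -mulr_suml ler_wpM2r.
  rewrite [leRHS](bigID Q)/= -[leLHS]addr0 lerD//; last first.
    by apply: sumr_ge0 => j _; rewrite mulr_ge0.
  apply: ler_sum => j _; rewrite -mulrBl normrM (ger0_norm (p0 j)) mulrC.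
  by rewrite ler_wpM2l.
have ge_s F1 (Q : pred 'I_K) : s <= \sum_(j | Q j) gain H F1 k j * p j 0 + s.
  by rewrite lerDr; apply: sumr_ge0 => j _; rewrite mulr_ge0 ?gain_ge0.
have step x y : s <= x -> s <= y -> `|x - y| <= P * d -> ln x - ln y <= P * d / s.
  move=> sx sy xy; apply: le_trans (ln_lipschitz s0 sx sy) _.
  by rewrite ler_wpM2r// invr_ge0 ltW.
have S := step _ _ (ge_s F predT) (ge_s F' predT) (dist predT).
have I : ln (interference s p F' H k) - ln (interference s p F H k) <= P * d / s.
  by apply: step; [exact: ge_s | exact: ge_s | rewrite distrC; exact: dist].
have -> : 2 * P / s * d = P * d / s + P * d / s by ring.
exact: subB_le2 S I.
Qed.

Lemma rate_term_ge0 (s : R) p F H k : 0 < s -> (forall k, 0 <= p k 0) ->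
  0 <= log2 (1 + gain H F k k * p k 0
                   / (\sum_(j < K | j != k) gain H F k j * p j 0 + s)).
Proof.
move=> s0 p0; rewrite divr_ge0 ?ln_ge0 ?ler1n// lerDl.
apply: divr_ge0; first by rewrite mulr_ge0 ?gain_ge0.
apply: addr_ge0; last exact: ltW.
by apply: sumr_ge0 => j _; rewrite mulr_ge0 ?gain_ge0.
Qed.

Lemma rate_ge0 (s : R) p F H : 0 < s -> (forall k, 0 <= p k 0) -> 0 <= rate s p F H.
Proof. by move=> s0 p0; apply: sumr_ge0 => k _; apply: rate_term_ge0. Qed.

End Rate.

(** * Designs built from bits, and Lipschitz dependence of the rate on the bits *)

Section Codesign.
Variables (R : realType) (K N b : nat) (D : {set port K N * port K N}).
Variables (Z0 PT : R) (D_sym : forall i j, ((i, j) \in D) = ((j, i) \in D)).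
Implicit Types (U : design R b D) (p : 'cV[R]_K) (H : 'M[R[i]]_(K, N)).

Definition bit_symmetric (x : edge D -> 'I_b -> R) : Prop :=
  forall (e e' : edge D) l, edge_src e' = edge_dst e ->
    edge_dst e' = edge_src e -> x e' l = x e l.

(** [insub] fails exactly on the disconnected pairs, which get the value 0. *)
Definition branch_of_bits (x : edge D -> 'I_b -> R) : 'M[R]_(K + N) :=
  \matrix_(i, j) if insub (i, j) is Some e then \sum_(l < b) 2 ^+ l * x e l else 0.

(** Powers and bits determine a design: the beam is the solution given by [beam_eqP]. *)
Definition design_of_bits p (x : edge D -> 'I_b -> R) : design R b D :=
  let W := branch_of_bits x in
  Design p (2 *: (transfer Z0 W *m I1bar R K N) - I1bar R K N) (laplacian W) W x.

Lemma connected_sym i j : ((i, j) \in connected D) = ((j, i) \in connected D).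
Proof. by rewrite !in_setC D_sym. Qed.

Lemma feasible_design_of_bits p x : bit_symmetric x ->
  (forall k, 0 <= p k 0) -> \sum_k p k 0 <= PT ->
  feasible_design Z0 PT (design_of_bits p x).
Proof.
move=> symx p0 pPT.
have symW : (branch_of_bits x)^T = branch_of_bits x.
  apply/matrixP => i j; rewrite !mxE.
  case: insubP => [e ie ve|ie]; case: insubP => [e' ie' ve'|ie'] //.
  - by apply: eq_bigr => l _; congr (_ * _); apply: symx;
      rewrite /edge_src /edge_dst ve ve'.
  - by rewrite connected_sym ie in ie'.
  - by rewrite connected_sym ie' in ie.
split => //=.
- by apply/beam_eqP => //; apply: tr_laplacian.
- by move=> i j ij; rewrite mxE (negPf ij).
- by move=> i; rewrite mxE eqxx (bigD1 i).
- by move=> i j ijD; rewrite mxE insubF// in_setC ijD.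
- by move=> e; rewrite mxE -surjective_pairing valK.
Qed.

(** By the symmetry of [D] the reversed pair is connected, so [insubd] returns it. *)
Definition swap_edge (e : edge D) : edge D :=
  insubd e (edge_dst e, edge_src e).

Lemma val_swap_edge e : val (swap_edge e) = (edge_dst e, edge_src e).
Proof.
by rewrite val_insubd connected_sym -surjective_pairing (valP e).
Qed.

Lemma swap_edgeK : involutive swap_edge.
Proof.
move=> e; apply: val_inj; rewrite val_swap_edge /edge_dst /edge_src val_swap_edge.
by rewrite /= -surjective_pairing.
Qed.

(** The penalty sees only the pairs with i <= j; reversal sends the other pairs injectively among
    these, whence the factor 2. *)
Lemma sum_edge_sym (f : edge D -> R) : (forall e, 0 <= f e) ->
  (forall e, f (swap_edge e) = f e) ->
  \sum_e f e <= 2 * \sum_(e | (edge_src e <= edge_dst e)%N) f e.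
Proof.
move=> f0 fs; rewrite (bigID (fun e => edge_src e <= edge_dst e)%N)/=.
rewrite mulrDl mul1r lerD2l (reindex_inj (inv_inj swap_edgeK)) /=.
rewrite (eq_bigr _ (fun e _ => fs e)) big_mkcond [leRHS]big_mkcond /=.
apply: ler_sum => e _; rewrite /edge_src /edge_dst val_swap_edge /= -ltnNge.
by rewrite -/(edge_src e) -/(edge_dst e); case: ltnP => [/ltnW->|_] //; case: ifP.
Qed.

(** The bit weights are at most 2^b; the factor 2 is that of [sum_edge_sym]. *)
Lemma l1norm_branch_le U U' : feasible_design Z0 PT U -> feasible_design Z0 PT U' ->
  l1norm (branch U - branch U') <=
  2 ^+ b * 2 * \sum_(l < b) \sum_(e : edge D | (edge_src e <= edge_dst e)%N)
    `|bit U e l - bit U' e l|.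
Proof.
move=> fU fU'; rewrite /l1norm pair_bigA /=.
rewrite (bigID [in connected D])/= [X in _ + X]big1 ?addr0 => [|[i j] /=]; last first.
  rewrite in_setC negbK => ijD.
  by rewrite !mxE (branch_disconnected fU)// (branch_disconnected fU')// subr0 normr0.
rewrite big_sub -mulrA exchange_big /=.
apply: le_trans (_ : \sum_e 2 ^+ b * \sum_l `|bit U e l - bit U' e l| <= _).
  apply: ler_sum => e _; rewrite !mxE (branch_bits fU) (branch_bits fU').
  rewrite -sumrB mulr_sumr; apply: le_trans (ler_norm_sum _ _ _) _.
  apply: ler_sum => l _; rewrite -mulrBr normrM ger0_norm ?exprn_ge0//.
  by rewrite ler_wpM2r// ler_weXn2l ?ler1n// ltnW.
rewrite -mulr_sumr ler_wpM2l ?exprn_ge0//; apply: sum_edge_sym => e.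
  by apply: sumr_ge0.
apply: eq_bigr => l _; congr (`|_ - _|).
  by apply: (bit_sym fU); rewrite /edge_src /edge_dst val_swap_edge.
by apply: (bit_sym fU'); rewrite /edge_src /edge_dst val_swap_edge.
Qed.

(** The product of three Lipschitz constants: rate in the gains, gains in the branch values, branch
    values in the bits. The level does not occur in it. *)
Definition rate_slope (s : R) H : R :=
  K%:R * (2 * PT / s / ln 2) * (16 * Z0 * channel_bound H ^+ 2) * (2 ^+ b * 2).

Lemma rate_slope_ge0 s H : 0 < s -> 0 <= PT -> 0 <= Z0 -> 0 <= rate_slope s H.
Proof.
move=> s0 PT0 Z00.
by rewrite !mulr_ge0 ?invr_ge0 ?exprn_ge0 ?ln_ge0 ?ler1n ?channel_bound_ge0// ltW.
Qed.

Lemma design_rate_lipschitz s H U U' : 0 < s -> 0 <= PT -> 0 <= Z0 ->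
  feasible_design Z0 PT U -> feasible_design Z0 PT U' -> power U = power U' ->
  rate s (power U) (beam U) H - rate s (power U') (beam U') H <=
  rate_slope s H * \sum_(l < b) \sum_(e : edge D | (edge_src e <= edge_dst e)%N)
    `|bit U e l - bit U' e l|.
Proof.
move=> s0 PT0 Z00 fU fU' <-.
have G k j := gain_lipschitz D_sym H k j Z00 fU fU'.
apply: le_trans (rate_lipschitz s0 (power_ge0 fU) (power_budget fU) G) _.
rewrite /rate_slope; set c := K%:R * _; set g := 16 * _ * _.
rewrite -(mulrA c) -(mulrA c) ler_wpM2l//.
  by rewrite !mulr_ge0 ?invr_ge0 ?ln_ge0 ?ler1n// ltW.
rewrite -mulrA ler_wpM2l ?l1norm_branch_le//.
by rewrite !mulr_ge0 ?exprn_ge0 ?channel_bound_ge0.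
Qed.

Lemma design_rate0 s H U : feasible_design Z0 PT U -> branch U = 0 ->
  rate s (power U) (beam U) H = 0.
Proof.
move=> fU W0; rewrite /rate big1// => k _; rewrite (gainE D_sym H k k fU) W0.
rewrite amplitude0 ComplexField.Normc.normc0 expr0n mulr0 !mul0r addr0.
by rewrite /log2 ln1 mul0r.
Qed.

End Codesign.

(** * Rank-one updates of an inverse matrix *)

Section RankOneUpdate.
Variables (F : fieldType) (n : nat).
Implicit Types (A : 'M[F]_n) (u w : 'cV[F]_n) (v : 'rV[F]_n).

Lemma mul_mx11E (A B : 'M[F]_1) : (A *m B) 0 0 = A 0 0 * B 0 0.
Proof. by rewrite mxE big_ord1. Qed.

(* Sherman-Morrison, multiplied out by its denominator so that the denominator
   may vanish. *)
Lemma rank_one_update A u v w (c : F) :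
  A \in unitmx -> A + c *: (u *m u^T) \in unitmx ->
  (1 + c * (u^T *m invmx A *m u) 0 0)
    * (v *m invmx (A + c *: (u *m u^T)) *m w) 0 0 =
  (1 + c * (u^T *m invmx A *m u) 0 0) * (v *m invmx A *m w) 0 0
    - c * ((v *m invmx A *m u) 0 0 * (u^T *m invmx A *m w) 0 0).
Proof.
move=> uA uA'; set A' := A + _ in uA' *.
have AE : A = A' - c *: (u *m u^T) by rewrite addrK.
have XE : invmx A' = invmx A - c *: (invmx A' *m u *m (u^T *m invmx A)).
  apply: (can_inj (mulmxK uA)); rewrite mulmxBl mulVmx// -scalemxAl -!mulmxA.
  by rewrite mulVmx// mulmx1 {1}AE mulmxBr mulVmx// -scalemxAr.
have E w' : (v *m invmx A' *m w') 0 0 = (v *m invmx A *m w') 0 0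
    - c * ((v *m invmx A' *m u) 0 0 * (u^T *m invmx A *m w') 0 0).
  rewrite {1}XE mulmxBr mulmxBl -scalemxAr -scalemxAl -mul_mx11E !mulmxA.
  by rewrite [LHS]mxE [X in _ + X = _]mxE [X in _ - X = _]mxE.
(* [E u] gives v A^-1 u = (1 + c q) v A'^-1 u, which eliminates v A'^-1 u from [E w] without a
   division. *)
have := E u; rewrite (E w); set q := (u^T *m _ *m u) 0 0.
move/eqP; rewrite eq_sym subr_eq => /eqP ->; ring.
Qed.

(** If both updated values vanish, then (1 + c q) a = c r for c = c1 and c = c2. Subtraction gives q
    a = r, and then a = 0. *)
Lemma rank_one_nonvanishing A u v w (c1 c2 : F) : c1 != c2 -> A \in unitmx ->
  A + c1 *: (u *m u^T) \in unitmx -> A + c2 *: (u *m u^T) \in unitmx ->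
  (v *m invmx A *m w) 0 0 != 0 ->
  ((v *m invmx (A + c1 *: (u *m u^T)) *m w) 0 0 != 0) ||
  ((v *m invmx (A + c2 *: (u *m u^T)) *m w) 0 0 != 0).
Proof.
move=> c12 uA uA1 uA2; apply: contraNT.
rewrite negb_or !negbK => /andP[/eqP E1 /eqP E2].
have := rank_one_update v w uA uA1; have := rank_one_update v w uA uA2.
rewrite E1 E2 !mulr0; set a := (v *m _ *m w) 0 0; set q := (u^T *m _ *m u) 0 0.
set r := (v *m _ *m u) 0 0 * (u^T *m _ *m w) 0 0 => e2 e1.
have qr : q * a = r.
  apply/eqP; rewrite -subr_eq0; have : (c1 - c2) * (q * a - r) = 0.
    by transitivity ((1 + c1 * q) * a - c1 * r - ((1 + c2 * q) * a - c2 * r));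
      [ring | rewrite -e1 -e2 subrr].
  by move/eqP; rewrite mulf_eq0 (subr_eq0 c1) (negPf c12).
by apply/eqP; rewrite [RHS]e1 -qr; ring.
Qed.

End RankOneUpdate.

(** * The Laplacian after a change of one branch value *)

Section SymmetricEntry.
Variables (R : rcfType) (n : nat).
Implicit Types W : 'M[R]_n.

Definition set_sym W (i j : 'I_n) (t : R) : 'M[R]_n :=
  \matrix_(k, l) if ((k, l) == (i, j)) || ((k, l) == (j, i)) then t else W k l.

Lemma tr_set_sym W i j t : W^T = W -> (set_sym W i j t)^T = set_sym W i j t.
Proof.
move=> symW; apply/matrixP => k l; rewrite !mxE !xpair_eqE.
by rewrite (andbC (l == i)) (andbC (l == j)) orbC -{1}symW mxE.
Qed.

(** This is e_i - e_j for distinct ports and e_i for a self-pair, whose weight enters only one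
    diagonal entry. *)
Definition dipole (i j : 'I_n) : 'cV[R]_n :=
  \col_k ((k == i)%:R - ((i != j) && (k == j))%:R).

Lemma laplacian_set_sym W i j t : W^T = W ->
  laplacian (set_sym W i j t)
    = laplacian W + (t - W i j) *: (dipole i j *m (dipole i j)^T).
Proof.
move=> symW; have Wji : W j i = W i j by rewrite -{1}symW mxE.
(* The second indicator is switched off for i = j, so that a diagonal entry is not changed twice. *)
have setE k l : set_sym W i j t k l = W k l + (t - W i j)
    * ((k == i)%:R * (l == j)%:R + ((i != j) && (k == j))%:R * (l == i)%:R).
  rewrite mxE !xpair_eqE; have [ij|ij] := eqVneq i j.
    rewrite -ij orbb mul0r addr0.
    by case: eqP => [->|_]; case: eqP => [->|_];
      rewrite /= ?mulr1 ?mulr0 ?mul0r ?addr0 ?subrKC.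
  have [->|ki] := eqVneq k i.
    rewrite (negPf ij) mul0r addr0 mul1r orbF.
    by case: eqP => [->|_]; rewrite /= ?mulr1 ?mulr0 ?addr0 ?subrKC.
  have [->|kj] := eqVneq k j; rewrite /= mul0r add0r ?mul1r.
    by case: eqP => [->|_]; rewrite /= ?mulr1 ?mulr0 ?addr0 ?Wji ?subrKC.
  by rewrite mul0r mulr0 addr0.
move: (set_sym W i j t) setE => S setE.
apply/matrixP => k l; rewrite !mxE big_ord1 !mxE.
have [<-|kl] := eqVneq k l.
  under eq_bigr do rewrite setE.
  rewrite big_split -mulr_sumr big_split -!mulr_sumr /=.
  have sum1 x : \sum_m (m == x)%:R = 1 :> R.
    by rewrite (bigD1 x)//= eqxx big1 ?addr0// => m /negPf ->.
  rewrite !sum1; congr (_ + _ * _).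
  have [->|ki] := eqVneq k i; last first.
    by rewrite mulr1 add0r sub0r mulrNN; case: (_ && _); rewrite ?mulr1 ?mulr0.
  by rewrite andNb /= subr0 mul0r addr0.
rewrite setE opprD -mulrN; congr (_ + _ * _).
have lk : (l == k) = false by rewrite eq_sym (negPf kl).
have [ki|ki] := eqVneq k i.
  rewrite -ki lk andNb mul0r addr0 mul1r subr0 mul1r sub0r.
  by have [<-|//] := eqVneq l j; rewrite ?kl ?andbF.
have [kj|kj] := eqVneq k j; last by rewrite andbF /= !mul0r addr0 subr0 mul0r oppr0.
by rewrite -kj lk andbF mul0r add0r subr0 sub0r mulNr.
Qed.

End SymmetricEntry.

(** * Keeping a response nonzero while branch values are moved *)

Section Nonvanishing.
Variables (R : rcfType) (n : nat) (z : R).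
Implicit Types W : 'M[R]_n.

Definition response W (v : 'rV[R[i]]_n) (w : 'cV[R[i]]_n) : R[i] :=
  (v *m invmx (admittance z (laplacian W)) *m w) 0 0.

(** By [laplacian_set_sym] the admittance changes by a rank-one term with coefficient i z (t - W i
    j), and it stays invertible because the matrix stays symmetric. *)
Lemma response_set_sym W i j (t1 t2 : R) v w : z != 0 -> t1 != t2 -> W^T = W ->
  response W v w != 0 ->
  (response (set_sym W i j t1) v w != 0) || (response (set_sym W i j t2) v w != 0).
Proof.
move=> z0 t12 symW W0.
pose u := map_mx (real_complex R) (dipole R i j).
pose c t := 'i%C * z%:C * (t - W i j)%:C.
have AE t : admittance z (laplacian (set_sym W i j t))
            = admittance z (laplacian W) + c t *: (u *m u^T).
  rewrite (laplacian_set_sym i j t symW) /admittance map_mxD scalerDr addrA.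
  by rewrite map_mxZ scalerA map_mxM map_trmx.
have unitAt t : admittance z (laplacian W) + c t *: (u *m u^T) \in unitmx.
  by rewrite -AE unit_admittance// tr_laplacian// tr_set_sym.
rewrite /response !AE; apply: rank_one_nonvanishing => //.
  have iz0 : 'i%C * z%:C != 0 :> R[i].
    by rewrite mulf_neq0// eq_complex /= ?eqxx ?oner_eq0 ?andbF// andbT.
  rewrite -subr_eq0 -mulrBr mulf_neq0// -rmorphB /=.
  by rewrite opprD addrACA subrr addr0 eq_complex /= eqxx andbT subr_eq0.
by rewrite unit_admittance// tr_laplacian.
Qed.

(* The response is a Moebius function of each branch value separately, so each
   value in turn can be moved to one of [a], [- a] keeping it nonzero. *)
Lemma response_nonvanishing (a : R) (s : seq ('I_n * 'I_n)) W v w :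
  z != 0 -> a != 0 -> W^T = W -> response W v w != 0 ->
  exists W', [/\ W'^T = W', response W' v w != 0 &
    forall i j, if ((i, j) \in s) || ((j, i) \in s)
                then W' i j = a \/ W' i j = - a else W' i j = W i j].
Proof.
move=> z0 a0 symW W0; elim: s => [|[i j] s [W1 [symW1 W10 W1E]]]; first by exists W.
have aN : a != - a.
  by rewrite -subr_eq0 opprK -mulr2n -mulr_natr mulf_neq0// pnatr_eq0.
have aux t : t = a \/ t = - a -> response (set_sym W1 i j t) v w != 0 ->
  exists W', [/\ W'^T = W', response W' v w != 0 &
    forall k l, if ((k, l) \in (i, j) :: s) || ((l, k) \in (i, j) :: s)
                then W' k l = a \/ W' k l = - a else W' k l = W k l].
  move=> ta t0; exists (set_sym W1 i j t); split => //; first exact: tr_set_sym.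
  move=> k l; rewrite !inE mxE orbACA.
  have -> : ((l, k) == (i, j)) = ((k, l) == (j, i)) by rewrite !xpair_eqE andbC.
  by case: ((k, l) == (i, j)) => //; case: ((k, l) == (j, i)) => //; apply: W1E.
case/orP: (response_set_sym i j z0 aN symW1 W10); apply: aux; by [left | right].
Qed.

End Nonvanishing.

(** * Discrete designs of positive rate *)

Section PositiveRate.
Variables (R : realType) (K N b : nat) (D : {set port K N * port K N}).
Variables (Z0 PT : R) (D_sym : forall i j, ((i, j) \in D) = ((j, i) \in D)).
Implicit Types (U : design R b D) (H : 'M[R[i]]_(K, N)).

(** All connected branch values are moved to [a] or [- a] by [response_nonvanishing]; the
    disconnected ones keep their value 0. *)
Lemma exists_discrete_gain H U k : Z0 != 0 -> 0 <= PT -> (0 < b)%N ->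
  feasible_design Z0 PT U -> gain H (beam U) k k != 0 ->
  exists U', [/\ feasible_design Z0 PT U',
    forall e l, bit U' e l = - 1 \/ bit U' e l = 1,
    gain H (beam U') k k != 0 & power U' k 0 = PT].
Proof.
move=> Z00 PT0 b0 fU; rewrite (gainE D_sym H k k fU) => G0.
have W0 : response Z0 (branch U) (row k H *m I2bar R K N) (col k (I1bar R K N)) != 0.
  apply: contraNneq G0; rewrite /amplitude /transfer /response => ->.
  by rewrite ComplexField.Normc.normc0 expr0n mulr0.
(* The branch value of an edge whose bits all equal 1. *)
pose a : R := \sum_(l < b) 2 ^+ l.
have a0 : a != 0.
  rewrite gt_eqF// /a; case: b b0 => // b' _; rewrite big_ord_recl ltr_pwDl//.
  by apply: sumr_ge0 => l _; rewrite exprn_ge0.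
have [W [symW WN WE]] :=
  response_nonvanishing (enum (connected D)) Z00 a0 (sym_branch D_sym fU) W0.
(* All bits of an edge share one sign, that of its branch value. *)
pose x (e : edge D) (l : 'I_b) := W (edge_src e) (edge_dst e) / a.
have symx : bit_symmetric x.
  by move=> e e' l; rewrite /x => -> ->; rewrite -{1}symW mxE.
have WB : branch_of_bits x = W.
  apply/matrixP => i j; rewrite mxE; case: insubP => [e ie ve|ie].
    rewrite -mulr_suml -/a /x /edge_src /edge_dst ve /= mulrC divfK//.
  have ijD : (i, j) \in D by move: ie; rewrite in_setC negbK.
  have jiD : (j, i) \in D by rewrite -D_sym.
  have := WE i j; rewrite !mem_enum !in_setC ijD jiD /= => ->.
  by rewrite (branch_disconnected fU).
(* The whole budget goes to user [k], whose own signal is then positive. *)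
pose p : 'cV[R]_K := \col_j (PT *+ (j == k)).
have p0 j : 0 <= p j 0 by rewrite mxE mulrn_wge0.
have pPT : \sum_j p j 0 <= PT.
  rewrite (bigD1 k)//= mxE eqxx big1 ?addr0// => j jk.
  by rewrite mxE (negPf jk).
have fU' := feasible_design_of_bits Z0 D_sym symx p0 pPT.
exists (design_of_bits Z0 p x); split => //; last by rewrite mxE eqxx.
  move=> e l; rewrite /= /x.
  have := WE (edge_src e) (edge_dst e); rewrite !mem_enum -surjective_pairing (valP e) /=.
  by case=> ->; [right | left]; rewrite ?mulNr divff.
rewrite (gainE D_sym H k k fU') /= WB mulf_neq0 ?pnatr_eq0// expf_neq0//.
apply: contraNneq WN => /ComplexField.Normc.eq0_normc.
by rewrite /amplitude /transfer => E; apply/eqP.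
Qed.

(** A nonzero rate requires a user with nonzero own gain; the term of that user alone makes the new
    rate positive. *)
Lemma exists_discrete_rate_gt0 H U s : 0 < s -> Z0 != 0 -> 0 < PT -> (0 < b)%N ->
  feasible_design Z0 PT U -> rate s (power U) (beam U) H != 0 ->
  exists U', [/\ feasible_design Z0 PT U',
    forall e l, bit U' e l = - 1 \/ bit U' e l = 1 &
    0 < rate s (power U') (beam U') H].
Proof.
move=> s0 Z00 PT0 b0 fU r0.
have [k Gk] : exists k, gain H (beam U) k k != 0.
  apply/existsP; apply: contraNT r0; rewrite negb_exists => /forallP G0.
  rewrite /rate big1// => k _; have := G0 k; rewrite negbK => /eqP ->.
  by rewrite !mul0r addr0 /log2 ln1 mul0r.
have [U' [fU' bU' Gk' pk]] := exists_discrete_gain Z00 (ltW PT0) b0 fU Gk.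
exists U'; split => //.
have p0 := power_ge0 fU'.
rewrite /rate (bigD1 k)//= ltr_wpDr//.
  by apply: sumr_ge0 => j _; apply: rate_term_ge0.
rewrite divr_gt0 ?ln_gt0 ?ltr1n// ltrDl divr_gt0//.
  by rewrite pk mulr_gt0// lt_def Gk' gain_ge0.
rewrite ltr_wpDl//; apply: sumr_ge0 => i _; by rewrite mulr_ge0 ?gain_ge0.
Qed.

End PositiveRate.

(** * An abstract exact penalty principle *)

(** Relaxed points with [f] below [f y0] already lose to [y0], so rounding is asked only of the
    others. For those, a rho above rhobar makes any negative penalty cost strictly more than
    rounding does. *)
Lemma exact_penalty (R : realType) (T : Type) (relaxed strict : T -> Prop)
    (f pen : T -> R) (rhobar rho : R) (y0 : T) :
  0 < rhobar -> rhobar < rho ->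
  (forall x, strict x -> relaxed x) ->
  (forall x, relaxed x -> pen x <= 0) ->
  (forall x, relaxed x -> pen x = 0 <-> strict x) ->
  strict y0 ->
  (forall x, relaxed x -> f y0 <= f x ->
     exists2 x', strict x' & f x - f x' <= rhobar / 2 * - pen x) ->
  (forall x, maximizer strict f x ->
     maximizer relaxed (fun x => f x + rho / 2 * pen x) x) /\
  (forall x, maximizer relaxed (fun x => f x + rho / 2 * pen x) x ->
     strict x /\ maximizer strict f x).
Proof.
move=> rb0 rbr sub pen_le0 pen0 y0s rounding.
have obj_strict x : strict x -> f x + rho / 2 * pen x = f x.
  by move=> xs; rewrite (pen0 _ (sub _ xs)).2// mulr0 addr0.
split=> [x [xs xmax]|x [xr xmax]].
  split=> [|y yr]; first exact: sub.
  rewrite (obj_strict x xs); have py := pen_le0 y yr.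
  have [le_y|lt_y] := leP (f y0) (f y).
    have [y' y's] := rounding y yr le_y; have := xmax y' y's; nra.
  have := xmax y0 y0s; nra.
have px := pen_le0 x xr.
(* The penalty of [x] only lowers its objective, which is still at least that of [y0]. *)
have le_x : f y0 <= f x by have := xmax y0 (sub _ y0s); rewrite obj_strict//; nra.
have xs : strict x.
  apply/(pen0 x xr)/eqP; rewrite eq_le px leNgt; apply/negP => px0.
  (* With a negative penalty, the rounded point would be strictly better than [x]. *)
  have [x' x's] := rounding x xr le_x.
  by have := xmax x' (sub _ x's); rewrite obj_strict//; nra.
split=> //; split=> // y ys.
by have := xmax y (sub _ ys); rewrite !obj_strict.
Qed.

(** * Penalty, rounding and rate bounds for codebooks *)

Section Codebook.
Variables (R : realType) (K N b M : nat) (D : {set port K N * port K N}).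
Variables (Z0 PT sigma2 : R) (H : 'I_M -> 'M[R[i]]_(K, N)).
Hypotheses (M0 : (0 < M)%N) (Z00 : 0 < Z0) (PT0 : 0 < PT) (s0 : 0 < sigma2).
Hypothesis (D_sym : forall i j, ((i, j) \in D) = ((j, i) \in D)).
Implicit Types x y : codebook R b M D.

Local Notation feasible := (feasible_codebook Z0 PT).

Lemma box_sqr_le (c t : R) : - c <= t <= c -> 0 <= c ^+ 2 - t ^+ 2.
Proof.
case/andP=> ct tc; rewrite subr_sqr mulr_ge0 ?subr_ge0//.
by rewrite addrC -lerBlDr sub0r.
Qed.

Lemma penaltyE x : penalty x = - (M%:R^-1 * \sum_(m < M) \sum_(l < b)
    \sum_(e : edge D | (edge_src e <= edge_dst e)%N)
      (level x ^+ 2 - bit (sample x m) e l ^+ 2)).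
Proof.
rewrite /penalty -[RHS]mulrN -[X in _ = _ * X]sumrN; congr (_ * _).
apply: eq_bigr => m _; rewrite -[RHS]sumrN; apply: eq_bigr => l _.
rewrite -[RHS]sumrN; apply: eq_bigr => e _.
by rewrite opprB.
Qed.

Lemma penalty_le0 x : boxed_bits x -> penalty x <= 0.
Proof.
move=> bx; rewrite penaltyE oppr_le0 mulr_ge0 ?invr_ge0//.
by do 3!(apply: sumr_ge0 => ? _); apply: box_sqr_le; apply: bx.
Qed.

Lemma discrete_boxed x : 0 <= level x -> discrete_bits x -> boxed_bits x.
Proof. by move=> c0 dx m e l; case: (dx m e l) => ->; lra. Qed.

(** Up to sign the penalty is a sum of nonnegative terms, so it vanishes only termwise. *)
Lemma penalty_eq0 x : feasible x -> boxed_bits x -> penalty x = 0 <-> discrete_bits x.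
Proof.
move=> [_ fx] bx; rewrite penaltyE; split=> [/eqP|dx]; last first.
  rewrite [X in _ * X]big1 ?mulr0 ?oppr0// => m _.
  rewrite big1// => l _; rewrite big1// => e _.
  by case: (dx m e l) => ->; rewrite ?sqrrN subrr.
rewrite oppr_eq0 mulf_eq0 invr_eq0 pnatr_eq0 gtn_eqF//= => /eqP S0 m e l.
have box0 m' e' l' : 0 <= level x ^+ 2 - bit (sample x m') e' l' ^+ 2.
  by apply: box_sqr_le; apply: bx.
have half e' : (edge_src e' <= edge_dst e')%N ->
    bit (sample x m) e' l = - level x \/ bit (sample x m) e' l = level x.
  move=> le_e'.
  have S1_ge0 m' l' : 0 <= \sum_(e'' : edge D | (edge_src e'' <= edge_dst e'')%N)
      (level x ^+ 2 - bit (sample x m') e'' l' ^+ 2) by apply: sumr_ge0.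
  have S2_ge0 m' : 0 <= \sum_l' \sum_(e'' : edge D | (edge_src e'' <= edge_dst e'')%N)
      (level x ^+ 2 - bit (sample x m') e'' l' ^+ 2) by apply: sumr_ge0.
  have Sm := psumr_eq0P (fun m' _ => S2_ge0 m') S0 (i := m) isT.
  have Sl := psumr_eq0P (fun l' _ => S1_ge0 m l') Sm (i := l) isT.
  have /eqP := psumr_eq0P (fun e _ => box0 m e l) Sl le_e'.
  by rewrite subr_eq0 eq_sym eqf_sqr => /orP[] /eqP; [right | left].
(* The penalty covers the edges with i <= j; any other edge has the same bits as its reversal. *)
have [/half//|/ltnW dst_le] := leqP (edge_src e) (edge_dst e).
rewrite -(bit_sym (fx m) (e := e) (e' := swap_edge e));
  try by rewrite /edge_src /edge_dst (val_swap_edge D_sym).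
by apply: half; rewrite /edge_src /edge_dst (val_swap_edge D_sym).
Qed.

Definition bit_distance x y : R :=
  M%:R^-1 * \sum_(m < M) \sum_(l < b)
    \sum_(e : edge D | (edge_src e <= edge_dst e)%N)
      `|bit (sample x m) e l - bit (sample y m) e l|.

Lemma bit_distance_ge0 x y : 0 <= bit_distance x y.
Proof. by rewrite mulr_ge0 ?invr_ge0//; do 3!(apply: sumr_ge0 => ? _). Qed.

Definition average_slope : R := \sum_m rate_slope b Z0 PT sigma2 (H m).

Lemma average_slope_ge0 : 0 <= average_slope.
Proof. by apply: sumr_ge0 => m _; rewrite rate_slope_ge0 ?ltW. Qed.

Lemma average_rate_lipschitz x y : feasible x -> feasible y ->
  (forall m, power (sample x m) = power (sample y m)) ->
  average_rate sigma2 H x - average_rate sigma2 H y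
    <= average_slope * bit_distance x y.
Proof.
move=> [_ fx] [_ fy] pxy; rewrite /average_rate -mulrBr /bit_distance mulrCA.
rewrite ler_wpM2l ?invr_ge0// -sumrB mulr_sumr; apply: ler_sum => m _.
have := design_rate_lipschitz D_sym (H m) s0 (ltW PT0) (ltW Z00) (fx m) (fy m) (pxy m).
move/le_trans; apply; rewrite ler_wpM2r//.
  by do 2!(apply: sumr_ge0 => ? _).
rewrite /average_slope (bigD1 m)//= lerDl; apply: sumr_ge0 => i _.
by rewrite rate_slope_ge0 ?ltW.
Qed.

(** Keeps the level and the powers, as the Lipschitz bound compares designs of equal power, and
    recomputes the beams. *)
Definition with_bits x (t : 'I_M -> edge D -> 'I_b -> R) : codebook R b M D :=
  Codebook (level x) (fun m => design_of_bits Z0 (power (sample x m)) (t m)).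

Lemma feasible_with_bits x t : feasible x -> (forall m, bit_symmetric (t m)) ->
  feasible (with_bits x t).
Proof.
move=> [c0 fx] symt; split=> //= m; apply: feasible_design_of_bits => //.
  exact: power_ge0 (fx m).
exact: power_budget (fx m).
Qed.

Definition rounding x : codebook R b M D :=
  with_bits x (fun m e l => if 0 <= bit (sample x m) e l then level x else - level x).

Lemma feasible_rounding x : feasible x -> feasible (rounding x).
Proof.
move=> fx; apply: feasible_with_bits => // m e e' l src dst.
by rewrite (bit_sym (fx.2 m) l src dst).
Qed.

Lemma discrete_rounding x : discrete_bits (rounding x).
Proof. by move=> m e l /=; case: ifP => _; [right | left]. Qed.

(* Pointwise: c^2 - t^2 = (c - |t|) (c + |t|) >= c (c - |t|). *)
Lemma rounding_penalty x : 0 <= level x -> boxed_bits x ->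
  level x * bit_distance x (rounding x) <= - penalty x.
Proof.
move=> c0 bx; rewrite penaltyE opprK mulrCA ler_wpM2l ?invr_ge0// mulr_sumr.
apply: ler_sum => m _; rewrite mulr_sumr; apply: ler_sum => l _.
rewrite mulr_sumr; apply: ler_sum => e _ /=; have /andP[] := bx m e l.
set t := bit _ e l; set c := level x => ct tc.
case: (leP 0 t) => t0; first by rewrite ler0_norm; nra.
by rewrite ger0_norm; nra.
Qed.

(** Compares [x] with the codebook of zero bits, whose rate is 0 and whose bit distance to [x] is at
    most the number of bits per sample times the level. *)
Lemma average_rate_le_level x : feasible x -> boxed_bits x ->
  average_rate sigma2 H x <=
  average_slope * (b%:R * #|{: edge D}|%:R) * level x.
Proof.
move=> fx bx; pose z := with_bits x (fun _ _ _ => 0).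
have fz : feasible z by apply: feasible_with_bits.
have rz : average_rate sigma2 H z = 0.
  rewrite /average_rate big1 ?mulr0// => m _; apply: (design_rate0 D_sym _ _ (fz.2 m)).
  apply/matrixP => i j; rewrite !mxE; case: insubP => // e _ _.
  by rewrite big1// => l _; rewrite mulr0.
have := average_rate_lipschitz fx fz (fun=> erefl); rewrite rz subr0 => /le_trans; apply.
rewrite -mulrA ler_wpM2l ?average_slope_ge0// ler_pdivrMl ?ltr0n//.
have sum_cst n (t : R) : n%:R * t = \sum_(i < n) t.
  by rewrite sumr_const card_ord mulr_natl.
rewrite (sum_cst M); apply: ler_sum => m _.
rewrite -mulrA (sum_cst b); apply: ler_sum => l _.
rewrite mulr_natl -sumr_const [leRHS](bigID (fun e => edge_src e <= edge_dst e)%N)/=.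
have c0 := fx.1.
rewrite -[leLHS]addr0 lerD ?sumr_ge0//; apply: ler_sum => e _.
by rewrite subr0 ler_norml bx.
Qed.

End Codebook.

(** * Choice of the penalty threshold and of the reference point *)

Lemma codebook_exact_penalty (R : realType) (K N b M : nat)
    (D : {set port K N * port K N}) (Z0 PT sigma2 : R)
    (H : 'I_M -> 'M[R[i]]_(K, N)) :
  (0 < M)%N -> (0 < b)%N -> 0 < Z0 -> 0 < PT -> 0 < sigma2 ->
  (forall i j, ((i, j) \in D) = ((j, i) \in D)) ->
  exists2 rhobar : R, 0 < rhobar & exists2 y0 : codebook R b M D,
    feasible_codebook Z0 PT y0 /\ discrete_bits y0 &
    forall x : codebook R b M D, feasible_codebook Z0 PT x /\ boxed_bits x ->
      average_rate sigma2 H y0 <= average_rate sigma2 H x ->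
      average_rate sigma2 H x - average_rate sigma2 H (rounding Z0 x)
        <= rhobar / 2 * - penalty x.
Proof.
move=> M0 b0 Z00 PT0 s0 D_sym.
have [[y0 [fy0 dy0] ry0]|none] := boolp.EM (exists2 y : codebook R b M D,
    feasible_codebook Z0 PT y /\ discrete_bits y & 0 < average_rate sigma2 H y).
  have S0 := average_slope_ge0 b H Z00 PT0 s0.
  set S := average_slope b Z0 PT sigma2 H in S0.
  set v0 := average_rate sigma2 H y0 in ry0.
  (* The rate is at most [k] times the level, so points of rate at least [v0] have level at least v0
     / k. The added 1 makes [k] positive. *)
  pose k : R := S * (b%:R * #|{: edge D}|%:R) + 1.
  have k0 : 0 < k by apply: ltr_wpDl => //; apply: mulr_ge0 => //; apply: mulr_ge0.
  (* Rounding loses at most S d, while - penalty >= level d >= (v0 / k) d; the 2 cancels the half in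
     the objective. *)
  exists (2 * (S + 1) * k / v0).
    by rewrite divr_gt0// mulr_gt0// mulr_gt0// ltr_wpDl.
  exists y0 => // x [fx bx] v0x.
  have vk : v0 <= k * level x.
    apply: le_trans v0x (le_trans _ _).
      exact: (average_rate_le_level H M0 Z00 PT0 s0 D_sym fx bx).
    by rewrite /k mulrDl mul1r lerDl fx.1.
  have fr := feasible_rounding D_sym fx.
  have lip := average_rate_lipschitz H Z00 PT0 s0 D_sym fx fr (fun=> erefl).
  apply: le_trans lip _; rewrite -/S.
  have d0 := bit_distance_ge0 x (rounding Z0 x).
  have dp := rounding_penalty Z0 fx.1 bx.
  set d := bit_distance _ _ in d0 dp *.
  have -> : 2 * (S + 1) * k / v0 / 2 * - penalty x
            = (S + 1) * (k * - penalty x / v0) by field; rewrite gt_eqF.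
  apply: (@le_trans _ _ ((S + 1) * d)); first by nra.
  rewrite ler_wpM2l ?addr_ge0// ler_pdivlMr//.
  apply: (@le_trans _ _ (k * level x * d)); first by nra.
  by rewrite -mulrA ler_wpM2l// ltW.
have rate0 (x : codebook R b M D) :
    feasible_codebook Z0 PT x -> average_rate sigma2 H x = 0.
  move=> [_ fx]; rewrite /average_rate big1 ?mulr0// => m _.
  apply/eqP/negPn/negP => rx; apply: none.
  have [U [fU dU rU]] :=
    exists_discrete_rate_gt0 D_sym s0 (lt0r_neq0 Z00) PT0 b0 (fx m) rx.
  (* The same design in every sample: sample [m] has positive rate and the others have nonnegative
     rate. *)
  exists (Codebook 1 (fun=> U)); first by split=> // m' e l; apply: dU.
  rewrite mulr_gt0 ?invr_gt0 ?ltr0n// (bigD1 m)//= ltr_wpDr//.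
  by apply: sumr_ge0 => m' _; apply: rate_ge0 => // j; apply: (power_ge0 fU).
(* With all rates zero any positive threshold works. At level 0 the zero bits are discrete, which
   gives the reference point. *)
exists 1 => //; pose z := design_of_bits Z0 0 (fun (_ : edge D) (_ : 'I_b) => 0).
exists (Codebook 0 (fun=> z)).
  split; last by move=> m e l; right.
  split=> //= m; apply: feasible_design_of_bits => // [k|]; first by rewrite mxE.
  by rewrite big1 ?ltW// => k _; rewrite mxE.
move=> x [fx bx] _; rewrite !rate0//; last exact: feasible_rounding.
by rewrite subrr mul1r mulr_ge0 ?invr_ge0// oppr_ge0 penalty_le0.
Qed.

Theorem theorem2 (R : realType) (N K b M : nat)
  (hN : (0 < N)%N) (hK : (0 < K)%N) (hb : (0 < b)%N) (hM : (0 < M)%N)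
  (Z0 PT sigma2 : R) (hZ0 : 0 < Z0) (hPT : 0 < PT) (hsigma2 : 0 < sigma2)
  (H : 'I_M -> 'M[R[i]]_(K, N))
  (D : {set port K N * port K N})
  (D_irrefl : forall i : port K N, (i, i) \notin D)
  (D_sym : forall i j : port K N, ((i, j) \in D) = ((j, i) \in D))
  (D_connected : exists (k0 : 'I_K) (r0 : 'I_N),
     (lshift N k0, rshift K r0) \in connected D) :
  exists2 rhobar : R, 0 < rhobar &
    forall rho : R, rhobar < rho ->
      (forall x : codebook R b M D,
         SD_optimal Z0 PT sigma2 H x -> SC_optimal Z0 PT sigma2 H rho x) /\
      (forall x : codebook R b M D,
         SC_optimal Z0 PT sigma2 H rho x ->
         discrete_bits x /\ SD_optimal Z0 PT sigma2 H x).
Proof.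
have [rhobar rb0 [y0 y0s rounding_le]] :=
  codebook_exact_penalty H hM hb hZ0 hPT hsigma2 D_sym.
exists rhobar => // rho rb_rho.
pose strict (x : codebook R b M D) := feasible_codebook Z0 PT x /\ discrete_bits x.
pose relaxed (x : codebook R b M D) := feasible_codebook Z0 PT x /\ boxed_bits x.
have [||||SD_SC SC_SD] := @exact_penalty R _ relaxed strict
  (average_rate sigma2 H) (@penalty R K N b M D) rhobar rho y0 rb0 rb_rho _ _ _ y0s.
- by move=> x [fx dx]; split=> //; apply: discrete_boxed fx.1 dx.
- by move=> x [_ bx]; apply: penalty_le0.
- by move=> x [fx bx]; have E := penalty_eq0 hM D_sym fx bx; split=> [/E|[_ /E]].
- move=> x xr y0x; exists (rounding Z0 x); last exact: rounding_le.
  have [fx _] := xr; split; last exact: discrete_rounding.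
  exact: feasible_rounding.
by split=> // x /SC_SD [[_ dx] optx].
Qed.
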